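(* Let $n\ge1$ and $a_0,a_1\in\mathbb{R}$. Suppose $$F(p_1,\dots,p_n)=\sum_{k=0}^nc_k\,\sigma_k(p_1,\dots,p_n),$$ where the coefficients $c_0,\dots,c_n\in\mathbb{C}$ satisfy $c_{k-1}=a_1c_k-a_0c_{k+1}$ for $k=1,2,\dots,n-1$. Let $r_1,r_2\in\mathbb{C}$ be the (not necessarily distinct) roots of $r^2-a_1r+a_0=0$. Then $F$ must take one of the following forms. Case 1: $r_1\neq r_2$. Then $$F(p_1,\dots,p_n)=A\prod_{i=1}^n(p_i+r_1)+B\prod_{i=1}^n(p_i+r_2),\qquad A=\frac{c_{n-1}-c_nr_2}{r_1-r_2},\quad B=\frac{-(c_{n-1}-c_nr_1)}{r_1-r_2}.$$ Case 2: $r_1=r_2=u\neq0$. Then $$F(p_1,\dots,p_n)=A\prod_{i=1}^n(p_i+u)+Bu\cdot\frac{d}{du}\Bigl(\prod_{i=1}^n(p_i+u)\Bigr),\qquad A=c_n,\quad B=\frac{c_{n-1}}{u}-c_n.$$ Case 3: $r_1=r_2=0$. Then $$F(p_1,\dots,p_n)=c_n\,\sigma_n(p_1,\dots,p_n)+c_{n-1}\,\sigma_{n-1}(p_1,\dots,p_n).$$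
   Context: $\sigma_k(p_1,\dots,p_n)$ denotes the $k$-th elementary symmetric polynomial, with $\sigma_0=1$. The coefficients $c_n$ and $c_{n-1}$ are not required to be real in this statement. *)

(* Defs.v *)
From HB Require Import structures.
From mathcomp Require Import all_boot all_order all_algebra.
From mathcomp Require Import complex.
From mathcomp Require Import all_classical all_reals all_analysis.
(* Not imported: the notations of mpoly clash with those of the analysis
   library. *)
From mathcomp Require mpoly.

Set Implicit Arguments.
Unset Strict Implicit.
Unset Printing Implicit Defensive.

Import Order.TTheory GRing.Theory Num.Theory.
Import numFieldNormedType.Exports.

Local Open Scope ring_scope.
Local Open Scope complex_scope.

(* The value at p of the k-th elementary symmetric polynomial in n variables;
   it is 1 for k = 0. *)
Definition sigma (R : realType) (n k : nat) (p : 'I_n -> R[i]) : R[i] :=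
  mpoly.meval p (mpoly.mesym n R[i] k).

(* The complex derivative of f at u. The ascription to numClosedFieldType is
   what gives R[i] the topology and norm of a numerical field. *)
Definition complex_deriv (R : realType) (f : R[i] -> R[i]) (u : R[i]) : R[i] :=
  @derive1 (R[i] : numClosedFieldType) ((R[i] : numClosedFieldType)^o) f u.

(* Main.v *)
(* Read backwards, the hypothesis says that d j = c (n - j) satisfies the linear
   recurrence d (j+2) = (r1 + r2) d (j+1) - r1 r2 d j, so d is determined by d 0
   and d 1: it is A r1^j + B r2^j, (A + B j) u^j, or supported on {0, 1}
   respectively. Since \prod_i (p_i + v) = \sum_k sigma_k(p) v^(n-k), summing
   against the sigma_k turns these closed forms into the three expressions. *)
Require Import Defs.
From mathcomp Require Import all_boot all_order all_algebra.
From mathcomp Require Import complex.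
From mathcomp Require Import all_classical all_reals all_analysis.
From mathcomp Require Import ring zify.

Import Order.TTheory GRing.Theory Num.Theory.

Local Open Scope ring_scope.
Local Open Scope complex_scope.

(** Expanding the product amounts to choosing the set [J] of indices that contribute [p i]; the sets
    of size [k] together give the factor of [v ^+ (n - k)]. *)
Lemma prod_addr_mesym (K : comNzRingType) (n : nat) (p : 'I_n -> K) (v : K) :
  \prod_(i < n) (p i + v) =
  \sum_(k < n.+1) mpoly.meval p (mpoly.mesym n K k) * v ^+ (n - k).
Proof.
have cardJ (J : {set 'I_n}) : (#|J| < n.+1)%N.
  by rewrite ltnS -[X in (_ <= X)%N]card_ord max_card.
rewrite bigA_distr (partition_big (fun J => Ordinal (cardJ J)) predT) //=.
apply: eq_bigr => k _.
rewrite /mpoly.mesym (big_morph _ (mpoly.mevalD p) (mpoly.meval0 p)) mulr_suml.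
apply: eq_big => [J|J /eqP <-]; first by rewrite -val_eqE.
rewrite (big_morph _ (mpoly.mevalM p) (mpoly.meval1 p)).
rewrite (bigID (mem J)) /=; congr (_ * _).
  by apply: eq_bigr => i iJ; rewrite iJ mpoly.mevalXU.
rewrite (eq_bigr (fun=> v)) => [|i /negbTE->//]; rewrite prodr_const.
by rewrite -[X in (X - _)%N]card_ord -(cardC J) addKn.
Qed.

(** Induction on two consecutive values. The recurrence for [d] stops at [n] because it will be
    applied to [c (n - j)], where truncated subtraction makes larger [j] meaningless. *)
Lemma linear_rec2_unique (K : pzRingType) (s q : K) (d e : nat -> K) (n : nat) :
  (forall j, (j.+2 <= n)%N -> d j.+2 = s * d j.+1 - q * d j) ->
  (forall j, e j.+2 = s * e j.+1 - q * e j) ->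
  d 0%N = e 0%N -> d 1%N = e 1%N -> forall j, (j <= n)%N -> d j = e j.
Proof.
move=> dS eS d0 d1; suff H j : (j <= n -> d j = e j)%N /\
    (j.+1 <= n -> d j.+1 = e j.+1)%N by move=> j /(H j).1.
elim: j => [|j [IHj IHSj]]; first by split.
by split=> // jn; rewrite dS // eS IHSj ?IHj // ltnW // ltnW.
Qed.

Lemma derive1_sum_exp (K : numFieldType) (n : nat) (s : 'I_n -> K)
    (m : 'I_n -> nat) (u : K) :
  derive1 ((fun v => \sum_(k < n) s k * v ^+ m k) : K^o -> K^o) u =
  \sum_(k < n) s k * ((m k)%:R * u ^+ (m k).-1).
Proof.
have -> : (fun v => \sum_(k < n) s k * v ^+ m k) =
    \sum_(k < n) (s k *: (@GRing.exp K ^~ (m k) : K^o -> K^o)).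
  by apply/funext => v; rewrite fct_sumE.
have dX k : derivable (@GRing.exp K ^~ (m k) : K^o -> K^o) u 1.
  exact: exprn_derivable.
rewrite derive1E derive_sum => [|k]; last exact: derivableZ.
apply: eq_bigr => k _.
by rewrite deriveZ // exp_derive; congr (_ * _); exact: mulr1.
Qed.

Theorem proposition5p4 (R : realType) (n : nat) (hn : (1 <= n)%N)
    (a0 a1 : R) (c : nat -> R[i])
    (hc : forall k : nat, (1 <= k <= n - 1)%N ->
       c (k - 1)%N = a1%:C * c k - a0%:C * c (k + 1)%N)
    (F : ('I_n -> R[i]) -> R[i])
    (hF : forall p : 'I_n -> R[i], F p = \sum_(0 <= k < n.+1) c k * sigma k p)
    (r1 r2 : R[i])
    (hr : 'X^2 - (a1%:C)%:P * 'X + (a0%:C)%:P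
          = ('X - r1%:P) * ('X - r2%:P) :> {poly R[i]}) :
  [/\ r1 <> r2 ->
        let A := (c (n - 1)%N - c n * r2) / (r1 - r2) in
        let B := - (c (n - 1)%N - c n * r1) / (r1 - r2) in
        forall p : 'I_n -> R[i],
          F p = A * \prod_(i < n) (p i + r1) + B * \prod_(i < n) (p i + r2),
      forall u : R[i], r1 = u -> r2 = u -> u <> 0 ->
        let A := c n in
        let B := c (n - 1)%N / u - c n in
        forall p : 'I_n -> R[i],
          F p = A * \prod_(i < n) (p i + u)
                + B * u * complex_deriv (fun v => \prod_(i < n) (p i + v)) u
    & r1 = 0 -> r2 = 0 ->
        forall p : 'I_n -> R[i],
          F p = c n * sigma n p + c (n - 1)%N * sigma (n - 1)%N p].

Proof.
(* Evaluating the factorization at 0 and at 1 yields Vieta's formulas. *)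
have rootE x : x ^+ 2 - a1%:C * x + a0%:C = (x - r1) * (x - r2).
  by have /(congr1 (horner^~ x)) := hr; rewrite !hornerE.
have a0E : a0%:C = r1 * r2.
  by have := rootE 0; rewrite expr0n mulr0 subrr add0r !sub0r mulrNN.
have a1E : a1%:C = r1 + r2.
  have -> : a1%:C = 1 + a0%:C - (1 ^+ 2 - a1%:C * 1 + a0%:C) by ring.
  by rewrite rootE a0E; ring.
(* Each case now reduces to a closed form [e] that solves the recurrence and has the right two
   initial values. *)
have cE e : (forall j, e j.+2 = (r1 + r2) * e j.+1 - r1 * r2 * e j) ->
    c n = e 0%N -> c (n - 1)%N = e 1%N ->
    forall p, F p = \sum_(k < n.+1) e (n - k)%N * sigma k p.
  move=> eS e0 e1 p; rewrite hF big_mkord; apply: eq_bigr => k _.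
  have kn : (k <= n)%N by rewrite -ltnS.
  pose d j := c (n - j)%N.
  rewrite -(linear_rec2_unique _ (r1 + r2) (r1 * r2) d e n) /d;
    rewrite ?subKn ?subn0 ?leq_subr //.
  move=> j jn; rewrite -a1E -a0E.
  (* At [k = n - (j + 1)] the neighbours [k - 1] and [k + 1] are [n - (j + 2)] and [n - j]; the
     bound [j + 2 <= n] gives [1 <= k <= n - 1]. *)
  have := hc (n - j.+1)%N; rewrite -subnDA addn1 => -> //.
    by congr (_ * _ - _ * c _); lia.
  by lia.
split.
- move=> /eqP; rewrite -subr_eq0 => r12 A B p.
  (* [A] and [B] solve [A + B = c n] and [A * r1 + B * r2 = c (n - 1)]. *)
  rewrite (cE (fun j => A * r1 ^+ j + B * r2 ^+ j)).
  + rewrite !prod_addr_mesym !mulr_sumr -big_split; apply: eq_bigr => k _ /=.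
    by rewrite mulrDl !(mulrC (sigma _ _)) !mulrA.
  + by move=> j; rewrite !exprS; ring.
  + by rewrite /A /B !expr0; field.
  + by rewrite /A /B !expr1; field.
- move=> u r1u r2u /eqP u0 A B p.
  (* The term [j * u ^+ j] is [u] times the derivative of [u ^+ j], whence the derivative of the
     product. *)
  rewrite (cE (fun j => (A + B * j%:R) * u ^+ j)).
  + rewrite /complex_deriv.
    have -> : (fun v => \prod_(i < n) (p i + v)) =
        (fun v => \sum_(k < n.+1) sigma k p * v ^+ (n - k)).
      by apply/funext => v; rewrite prod_addr_mesym.
    rewrite (derive1_sum_exp _ _ (fun k => sigma k p) (fun k => n - k)%N u).
    rewrite prod_addr_mesym !mulr_sumr -big_split; apply: eq_bigr => k _ /=.
    (* The exponent [(n - k).-1] is truncated at [k = n], where its factor is 0; otherwise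
       [u * u ^+ m = u ^+ m.+1]. *)
    rewrite -/(sigma k p); case: (n - k)%N => [|m] /=;
      rewrite ?expr0 ?exprS; ring.
  + by move=> j; rewrite r1u r2u !exprS -[j.+2%:R]natr1 -[j.+1%:R]natr1; ring.
  + by rewrite /A mulr0 addr0 expr0 mulr1.
  + by rewrite /A /B expr1; field.
- move=> r10 r20 p.
  rewrite (cE (fun j => c n * (j == 0%N)%:R + c (n - 1)%N * (j == 1%N)%:R)).
  (* Only the last two terms, [k = n] and [k = n - 1], survive. *)
  + case: n hn p {cE hc hF F} => // m _ p.
    rewrite !big_ord_recr /= big1 ?subnn ?subSnn ?subSS ?subn0 => [|k _].
      by rewrite !mulr0 !mulr1 add0r addr0 add0r addrC.
    rewrite subSn 1?ltnW //= eqSS subn_eq0 leqNgt ltn_ord.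
    by rewrite !mulr0 addr0 mul0r.
  + by move=> j; rewrite r10 r20 !mulr0 addr0 !mul0r subr0.
  + by rewrite mulr1 mulr0 addr0.
  + by rewrite mulr1 mulr0 add0r.
Qed.
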